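(* For all integers $d,\ell,n\ge 2$ with $n$ even, the graph $\mathcal{D}_{\ell}(\mathbb{Q}_n^d)$ has diameter at least \[\frac{n^{d-1}(n^2-1)}{6\ell^2}.\]
   Context: $\mathbb{Q}^d_n$ is the graph with vertex set $\{1,\dots,n\}^d$, where two vertices are adjacent if they differ in exactly one coordinate, by exactly $1$. A dimer configuration on a graph $G$ is a perfect matching; its edges are dimers. An alternating cycle is a cycle of even length in which every second edge is a dimer; switching it exchanges dimer and non-dimer edges along the cycle. For $\ell\ge 2$, $\mathcal{D}_\ell(G)$ is the graph on dimer configurations of $G$ in which two configurations are adjacent if one is obtained from the other by switching an alternating cycle of length at most $2\ell$. *)

(* Defs.v *)
From HB Require Import structures.
From mathcomp Require Import all_boot all_order all_algebra.
From mathcomp Require Import constructive_ereal.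
Set Implicit Arguments.
Unset Strict Implicit.
Unset Printing Implicit Defensive.

Import Order.TTheory GRing.Theory Num.Theory.

(* A simple graph on a finite type T is given by its adjacency relation
   e : rel T; the edge joining x and y is the pair [set x; y]. *)

Section Diameter.
Variables (T : finType) (e : rel T).

Definition walk (k : nat) (x y : T) : bool :=
  [exists p : k.-tuple T, path e x p && (last x p == y)].

Lemma connect_walk (x y : T) : connect e x y -> exists k, walk k x y.
Proof.
case/connectP=> p ep ->; exists (size p).
by apply/existsP; exists (in_tuple p); rewrite ep eqxx.
Qed.

(* Vertices in different connected components are at distance +oo, so that a
   disconnected graph has diameter +oo. *)
Definition gdist (x y : T) : \bar rat :=
  match boolP (connect e x y) with
  | AltTrue cxy => ((ex_minn (connect_walk cxy))%:R%R)%:E%E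
  | AltFalse _ => +oo%E
  end.

Definition diameter : \bar rat :=
  \big[Order.max/0%E]_(x : T) \big[Order.max/0%E]_(y : T) gdist x y.

End Diameter.

Section Dimers.
Variables (T : finType) (e : rel T).

Definition edges : {set {set T}} :=
  [set [set p.1; p.2] | p in [set p : T * T | e p.1 p.2]].

Definition perfect_matching (M : {set {set T}}) : bool :=
  (M \subset edges) && [forall x : T, #|[set f in M | x \in f]| == 1].

Record dimer_config : Type :=
  DimerConfig { dimers :> {set {set T}}; _ : perfect_matching dimers }.
HB.instance Definition _ := [isSub for dimers].
HB.instance Definition _ := [Finite of dimer_config by <:].

Definition cycle_edges (c : seq T) : {set {set T}} :=
  [set [set x; next c x] | x in c].

Definition graph_cycle (c : seq T) : bool :=
  [&& 2 < size c, cycle e c & uniq c].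

(* The last condition says that, of any two consecutive edges of the cycle,
   exactly one is a dimer. *)
Definition alternating (M : {set {set T}}) (c : seq T) : bool :=
  [&& graph_cycle c, ~~ odd (size c) &
      [forall x in c, ([set x; next c x] \in M)
                  (+) ([set next c x; next c (next c x)] \in M)]].

Definition switch (M : {set {set T}}) (c : seq T) : {set {set T}} :=
  (M :\: cycle_edges c) :|: (cycle_edges c :\: M).

Definition switchable (l : nat) (M N : dimer_config) : bool :=
  [exists k : 'I_(2 * l).+1, exists c : k.-tuple T,
     alternating M c && (dimers N == switch M c)].

Definition dimer_graph (l : nat) : rel dimer_config :=
  [rel M N | switchable l M N || switchable l N M].

End Dimers.

Arguments dimer_graph {T} e l.

(* The coordinates range over {0, ..., n-1} instead of {1, ..., n}. *)
Definition grid (d n : nat) : rel {ffun 'I_d -> 'I_n} :=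
  [rel x y : {ffun 'I_d -> 'I_n} | [exists i : 'I_d,
     (((x i).+1 == y i :> nat) || ((y i).+1 == x i :> nat)) &&
     [forall (j | j != i), x j == y j]]].

Arguments grid : clear implicits.

(* Main.v *)
(* Orient every dimer from its even to its odd vertex, project it to the first
   two coordinates, and let W be the sum of x dy over the projected dimers,
   taken twice.  Switching an alternating cycle of length N <= 2l changes W by
   twice the integral of x dy along the projected closed walk; if the walk has
   a horizontal and b vertical steps, this is at most ab <= N^2/4 <= l^2.

   On one two-dimensional slice, take alternate edges of the concentric
   boundary squares, starting at the corners on the left and right sides.  The
   square with side s (odd, < n) contributes -s(s+1) to W up to the sign given
   by the parity of the slice, whereas horizontal dimers contribute 0.  Using
   the squares on the slices of one parity and horizontal dimers on those of
   the other parity, and exchanging the two roles, gives two configurations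
   whose values of W differ by n^(d-2) times the sum of s(s+1) over odd s < n,
   which is at least n^(d-1)(n^2-1)/6. *)

Require Import Defs.
From mathcomp Require Import all_boot all_order all_algebra.
From mathcomp Require Import constructive_ereal.
From mathcomp Require Import zify ring lra.
Import Order.TTheory GRing.Theory Num.Theory.
Local Open Scope ring_scope.

(** * Area of closed lattice walks *)

Lemma le_variation (a : nat -> int) (m k : nat) : (m <= k)%N ->
  `|a k - a m| <= \sum_(m <= i < k) `|a i.+1 - a i|.
Proof. by move=> mk; rewrite -(telescope_sumr a mk) ler_norm_sum. Qed.

(** Since [b] closes up, [a] may be measured from [a 0]. The walk leaves and returns, so this
    deviation is at most half the variation [A]; twice the sum is then at most [A * B], and 4AB is
    at most (A + B)^2. *)
Lemma closed_walk_area (N : nat) (a b : nat -> int) :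
  a N = a 0 -> b N = b 0 ->
  (forall i, (i < N)%N -> `|a i.+1 - a i| + `|b i.+1 - b i| <= 1) ->
  8 * `|\sum_(i < N) a i * (b i.+1 - b i)| <= N%:Z ^+ 2.
Proof.
move=> aN bN step.
set A := \sum_(0 <= i < N) `|a i.+1 - a i|.
set B := \sum_(0 <= i < N) `|b i.+1 - b i|.
have dev i : (i < N)%N -> 2 * `|a i - a 0| <= A.
  move=> iN; rewrite mulr2n mulrDl mul1r /A.
  rewrite (big_cat_nat (n := i)) ?(ltnW iN) //=.
  by rewrite lerD ?le_variation // -{1}aN distrC le_variation // ltnW.
have ABN : A + B <= N%:Z.
  rewrite -big_split /=.
  have -> : N%:Z = \sum_(0 <= i < N) 1 :> int.
    by rewrite sumr_const_nat subn0 /= -mulr_natr mul1r natz.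
  by apply: ler_sum_nat => i /andP[_ iN]; apply: step.
have A0 : 0 <= A by rewrite sumr_ge0.
have B0 : 0 <= B by rewrite sumr_ge0.
have -> : \sum_(i < N) a i * (b i.+1 - b i) =
          \sum_(i < N) (a i - a 0) * (b i.+1 - b i).
  apply/eqP; rewrite -subr_eq0 -sumrB.
  under eq_bigr => i _ do rewrite -mulrBl subKr.
  by rewrite -mulr_sumr -(big_mkord xpredT (fun i => b i.+1 - b i))
    telescope_sumr // bN subrr mulr0.
have AB : 2 * `|\sum_(i < N) (a i - a 0) * (b i.+1 - b i)| <= A * B.
  rewrite /B big_mkord mulr_sumr.
  apply: (@le_trans _ _ (2 * \sum_(i < N) `|(a i - a 0) * (b i.+1 - b i)|)).
    by rewrite ler_pM2l // ler_norm_sum.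
  rewrite mulr_sumr; apply: ler_sum => i _.
  by rewrite normrM mulrA ler_wpM2r // dev.
apply: (@le_trans _ _ ((A + B) ^+ 2)); last first.
  by rewrite lerXn2r ?nnegrE ?addr_ge0.
have := sqr_ge0 (A - B); lra.
Qed.

Section CycleOrbit.
Context {T : eqType} (x0 : T) (s : seq T).
Hypothesis Us : uniq (x0 :: s).
Let f := next (x0 :: s).

(** Makes a cycle an integer-indexed closed walk, the form needed for [closed_walk_area]. *)
Lemma traject_next : x0 :: s = traject f x0 (size s).+1
   /\ iter (size s).+1 f x0 = x0.
Proof.
have := cycle_next Us; rewrite -/f /= rcons_path => /andP[fp /eqP fl].
case/fpathP: (fp) => m sE.
have es : s = traject f (f x0) (size s) by rewrite {2}sE size_traject -sE.
split; first by rewrite {1}es.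
have lE : last x0 s = iter (size s) f x0 by rewrite {1}es last_traject.
by rewrite /= -lE.
Qed.

End CycleOrbit.

Lemma big_traject (T : Type) (f : T -> T) x0 (F : T -> int) n :
  \sum_(x <- traject f x0 n) F x = \sum_(i < n) F (iter i f x0).
Proof.
elim: n => [|n IH]; rewrite ?big_nil ?big_ord0 //.
by rewrite trajectSr big_rcons /= IH big_ord_recr.
Qed.

(** * Moments of dimer configurations and their change under switching *)

Section Moment.
Context {T : finType} (e : rel T) (par : T -> bool) (X Y : T -> int).
Hypothesis par_e : forall u v, e u v -> par v = ~~ par u.
Hypothesis step_e : forall u v, e u v -> `|X v - X u| + `|Y v - Y u| <= 1.

(* For a dimer {u, v} both ordered pairs contribute equally, which makes this
   twice the integral of x dy from the even to the odd vertex. *)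
Definition moment (f : {set T}) : int :=
  \sum_(u in f) \sum_(v in f) (-1) ^+ par u * X u * (Y v - Y u).

Definition total_moment (M : {set {set T}}) : int := \sum_(f in M) moment f.

Lemma edge_neq u v : e u v -> u != v.
Proof. by move=> /par_e puv; apply: contra_eq_neq puv => ->; case: (par v). Qed.

(** The two orientations differ by a multiple of (X v - X u)(Y v - Y u), which vanishes because a
    step changes at most one of [X] and [Y]. *)
Lemma moment_edge u v : e u v ->
  moment [set u; v] = 2 * ((-1) ^+ par u * (X u * (Y v - Y u))).
Proof.
move=> euv; have uv := edge_neq _ _ euv.
rewrite /moment !big_setU1 ?inE //= !big_set1 !big_setU1 ?inE //= !big_set1.
rewrite (par_e _ _ euv) !subrr !mulr0 add0r addr0 signrN.
have XY : (X v - X u) * (Y v - Y u) = 0.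
  have := step_e _ _ euv; set a := X v - X u; set b := Y v - Y u => ab.
  apply/eqP; rewrite mulf_eq0; lia.
have -> : X v = (X v - X u) + X u by rewrite subrK.
transitivity ((-1) ^+ par u *
    ((X v - X u) * (Y v - Y u) + 2 * (X u * (Y v - Y u)))); first by ring.
by rewrite XY add0r; ring.
Qed.

Lemma total_moment_switch (M : {set {set T}}) (c : seq T) :
  total_moment (switch M c) - total_moment M =
  \sum_(f in cycle_edges c) (-1) ^+ (f \in M) * moment f.
Proof.
rewrite /total_moment /switch (big_setID (cycle_edges c)) /=.
rewrite [X in _ - X](big_setID (cycle_edges c)) /=.
rewrite [RHS](big_setID M) /=.
have -> : ((M :\: cycle_edges c) :|: (cycle_edges c :\: M)) :&: cycle_edges c =
          cycle_edges c :\: M.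
  by apply/setP=> f; rewrite !inE; case: (f \in M); case: (f \in cycle_edges c).
have -> : ((M :\: cycle_edges c) :|: (cycle_edges c :\: M)) :\: cycle_edges c =
          M :\: cycle_edges c.
  by apply/setP=> f; rewrite !inE; case: (f \in M); case: (f \in cycle_edges c).
rewrite opprD addrACA subrr addr0 addrC setIC -sumrN; congr (_ + _).
  by apply: eq_bigr => f /setIP[_ ->]; rewrite mulN1r.
by apply: eq_bigr => f /setDP[_ /negbTE->]; rewrite mul1r.
Qed.

Lemma sum_cycle_edges (M : {set {set T}}) x0 s (F : {set T} -> int)
    (v := fun i => iter i (next (x0 :: s)) x0) :
  alternating e M (x0 :: s) ->
  \sum_(f in cycle_edges (x0 :: s)) F f =
  \sum_(i < (size s).+1) F [set v i; v i.+1].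
Proof.
case/and3P=> /and3P[_ _ Uc] _ /forall_inP alt.
have [cE _] := traject_next x0 s Uc.
rewrite /cycle_edges; set f := next (x0 :: s) in v cE alt *.
rewrite big_imset; last first.
  (* Distinct vertices giving the same edge would succeed each other, so two consecutive edges would
     coincide, against alternation. *)
  move=> x y xc yc /setP eq_xy; apply/eqP; apply: contraT => xy.
  have := eq_xy x; rewrite !inE eqxx (negPf xy) /= => /esym/eqP xE.
  have := eq_xy y; rewrite !inE eqxx [y == x]eq_sym (negPf xy) /= => /eqP yE.
  by have := alt y yc; rewrite -xE -yE setUC addbb.
by rewrite -(big_traject _ f x0 (fun x => F [set x; f x])) -cE big_uniq.
Qed.

Lemma total_moment_alternating (M : {set {set T}}) (c : seq T) :
  alternating e M c ->
  4 * `|total_moment (switch M c) - total_moment M| <= (size c)%:Z ^+ 2.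
Proof.
case: c => [|x0 s] Malt; first by case/and3P: Malt => /and3P[].
rewrite total_moment_switch (sum_cycle_edges _ _ _ _ Malt).
case/and3P: Malt => /and3P[_ ec Uc] _ /forall_inP alt.
have [_] := traject_next x0 s Uc.
set f := next (x0 :: s) in alt *; set v := fun i => iter i f x0 => vN.
have vc i : v i \in x0 :: s by elim: i => [|i IH]; rewrite ?mem_head ?mem_next.
have ev i : e (v i) (v i.+1) by apply: next_cycle.
(* Dimer membership and parity both change at every step, so the combined sign is constant and
   leaves the sum. *)
pose t i := ([set v i; v i.+1] \in M) (+) par (v i).
have tE i : t i = t 0.
  elim: i => // i <-; have := alt _ (vc i).
  rewrite /t (par_e _ _ (ev i)) /= -/(v i).
  by case: (_ \in M); case: (_ \in M); case: (par _).
under eq_bigr => i _.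
  rewrite (moment_edge _ _ (ev i)) [_ * (_ * _)]mulrCA.
  rewrite [(-1) ^+ (_ \in M) * _]mulrA.
  rewrite -signr_addb -/(t i) tE mulrCA.
  over.
rewrite -!mulr_sumr normrM normr_sign mul1r normrM [`|2|]ger0_norm // mulrA.
apply: (closed_walk_area _ (X \o v) (Y \o v)) => [||i _] /=.
- exact: (congr1 X vN).
- exact: (congr1 Y vN).
- exact: step_e (ev i).
Qed.

Lemma total_moment_walk (l k : nat) (M N : dimer_config e) :
  walk (dimer_graph e l) k M N ->
  `|total_moment N - total_moment M| <= k%:Z * l%:Z ^+ 2.
Proof.
have switchP (M' N' : dimer_config e) : switchable l M' N' ->
    `|total_moment N' - total_moment M'| <= l%:Z ^+ 2.
  case/existsP=> m /existsP[c /andP[altc /eqP->]].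
  rewrite -(@ler_pM2l _ 4) // (le_trans (total_moment_alternating _ _ altc)) //.
  rewrite size_tuple -[4]/(2 ^+ 2 : int) -exprMn lerXn2r ?nnegrE //.
  by have := ltn_ord m; lia.
case/existsP=> -[p /= /eqP <-] /andP[pth /eqP <-] {N k}.
elim: p M pth => [|N p IH] M /=; first by rewrite subrr normr0 mul0r.
case/andP=> MN /IH {}IH.
have step : `|total_moment N - total_moment M| <= l%:Z ^+ 2.
  by case/orP: MN => /switchP //; rewrite distrC.
rewrite intS mulrDl mul1r [leRHS]addrC.
apply: (le_trans (ler_distD (total_moment N) _ _)).
exact: lerD IH step.
Qed.

(** * Perfect matchings from involutions *)

Section Involution.
Context (p : T -> T).
Hypotheses (pK : involutive p) (ep : forall u, e u (p u)).

Definition partner_matching : {set {set T}} := [set [set u; p u] | u : T].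

Lemma partner_matching_cover x :
  [set f in partner_matching | x \in f] = [set [set x; p x]].
Proof.
apply/setP=> f; rewrite !inE; apply/andP/eqP => [[/imsetP[u _ ->]]|->].
  by rewrite !inE => /orP[]/eqP-> //; rewrite pK setUC.
by rewrite !inE eqxx; split=> //; apply/imsetP; exists x.
Qed.

Lemma partner_matchingP : perfect_matching e partner_matching.
Proof.
apply/andP; split.
  apply/subsetP=> f /imsetP[u _ ->]; apply/imsetP; exists (u, p u) => //.
  by rewrite inE ep.
by apply/forallP=> x; rewrite partner_matching_cover cards1.
Qed.

Lemma total_moment_partner : total_moment partner_matching =
  \sum_u (-1) ^+ par u * X u * (Y (p u) - Y u).
Proof.
rewrite /total_moment /moment (exchange_big_dep xpredT) //=.
apply: eq_bigr => u _.
rewrite (eq_bigl (mem [set [set u; p u]])); last first.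
  by move=> f; rewrite -partner_matching_cover !inE.
have up : u != p u := edge_neq _ _ (ep u).
by rewrite big_set1 big_setU1 ?inE // big_set1 subrr /= mulr0 add0r.
Qed.

End Involution.

End Moment.

(** * Arithmetic of concentric squares *)

(* On the interval [j, n-1-j], with n even, [flip j] exchanges j and j+1,
   j+2 and j+3, and so on. *)
Definition flip (j z : nat) : nat := if odd (z + j) then z.-1 else z.+1.

(** The smaller margin of two coordinates indexes the concentric square through a point. *)
Definition margin (n z : nat) : nat := minn z (n.-1 - z).

Lemma flip_margin n j z : ~~ odd n -> (z < n)%N -> (j <= margin n z)%N ->
  (flip j z < n)%N /\ (j <= margin n (flip j z))%N.
Proof. by rewrite /margin /flip => *; case: ifP => *; lia. Qed.

Lemma flipK n j z : ~~ odd n -> (z < n)%N -> (j <= margin n z)%N ->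
  flip j (flip j z) = z.
Proof.
rewrite /margin /flip => *; case: (boolP (odd (z + j))) => *;
  case: ifP => *; lia.
Qed.

Lemma flip_dist j z : (j <= z)%N ->
  ((flip j z).+1 == z) || (z.+1 == flip j z).
Proof. rewrite /flip; case: ifP => *; lia. Qed.

Lemma flipB j z : (j <= z)%N -> (flip j z)%:Z - z%:Z = (-1) ^+ (z + j).
Proof. rewrite /flip -signr_odd; case: ifP => /= *; lia. Qed.

(** With s = 2i + 1, the left side is three times the sum of s^2, while the summand on the right is
    s^2 + s. *)
Lemma sum_odd_mul_succ_ge m :
  m%:Z * (4 * m%:Z ^+ 2 - 1) <=
  3 * \sum_(i < m) (2 * i%:Z + 1) * (2 * i%:Z + 2).
Proof.
elim: m => [|m IH]; first by rewrite big_ord0.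
rewrite big_ord_recr /= mulrDr. set S := \sum_(_ < _) _ in IH *. 
have -> : m.+1%:Z = m%:Z + 1 by lia.
lia.
Qed.

Lemma sum_margin n j (c : int) : ~~ odd n -> (j <= n./2)%N ->
  \sum_(y < n | (j <= margin n y)%N) c = (n - j.*2)%:Z * c.
Proof.
move=> on jn; rewrite -(big_mkord (fun y => (j <= margin n y)%N) (fun=> c)).
transitivity (\sum_(j <= y < n - j) c).
  rewrite [RHS](big_nat_widen _ _ n) ?leq_subr // [RHS](big_nat_widenl _ 0) //.
  by apply: congr_big_nat => // y; rewrite /margin /=; lia.
by rewrite sumr_const_nat -subnDA addnn -mulr_natl natz.
Qed.

Lemma ring_sum n : ~~ odd n ->
  n%:Z * (n%:Z ^+ 2 - 1) <=
  6 * - \sum_(x < n) \sum_(y < n | (margin n x <= margin n y)%N)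
     (-1) ^+ (x + margin n x) * x%:Z.
Proof.
move=> on.
pose F x := (n - (margin n x).*2)%:Z * ((-1) ^+ (x + margin n x) * x%:Z).
have [m nE] : exists m, n = (m + m)%N by exists n./2; lia.
rewrite (eq_bigr (fun x : 'I_n => F x)); last first.
  by move=> x _; rewrite sum_margin // /margin; lia.
rewrite -(big_mkord xpredT F) (big_cat_nat (n := m)) ?nE ?leq_addr //=.
have -> : \sum_(m <= i < m + m) F i = \sum_(0 <= i < m) F (i + m)%N.
  by rewrite -{1}[m]add0n big_addn addnK.
(* Reversing the left half pairs columns m-1-i and m+i, which carry the vertical sides of the square
   of side 2i + 1. *)
rewrite big_nat_rev -big_split /=.
under eq_big_nat => i /andP[_ im].
  have -> : F (0 + m - i.+1)%N + F (i + m)%N =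
            - ((2 * i%:Z + 1) * (2 * i%:Z + 2)).
    rewrite /F.
    have -> : margin n (0 + m - i.+1) = (m - i.+1)%N by rewrite /margin; lia.
    have -> : margin n (i + m) = (m - i.+1)%N by rewrite /margin; lia.
    have -> : (-1) ^+ (0 + m - i.+1 + (m - i.+1)) = 1 :> int.
      rewrite -signr_odd.
      by have -> : odd (0 + m - i.+1 + (m - i.+1)) = false by lia.
    have -> : (-1) ^+ (i + m + (m - i.+1)) = - 1 :> int.
      by rewrite -signr_odd; have -> : odd (i + m + (m - i.+1)) by lia.
    have -> : (n - (m - i.+1).*2)%:Z = 2 * i%:Z + 2 by lia.
    have -> : (0 + m - i.+1)%:Z = m%:Z - i%:Z - 1 by lia.
    by rewrite PoszD; ring.
  over.
rewrite sumrN opprK big_mkord; have := sum_odd_mul_succ_ge m.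
set S := \sum_(_ < _) _.
by rewrite PoszD => ?; lra.
Qed.

(** * Coordinates and parity on the grid *)

Section Grid.
Context {d n : nat}.
Implicit Type u : {ffun 'I_d -> 'I_n}.

(** A value out of range leaves [u] unchanged. *)
Definition upd u (i : 'I_d) (k : nat) : {ffun 'I_d -> 'I_n} :=
  [ffun j => if j == i then insubd (u i) k else u j].

Lemma upd_same u i k : (k < n)%N -> upd u i k i = k :> nat.
Proof. by move=> kn; rewrite ffunE eqxx val_insubd kn. Qed.

Lemma upd_other u i j k : j != i -> upd u i k j = u j.
Proof. by move=> /negPf ji; rewrite ffunE ji. Qed.

Lemma updK u i k : upd (upd u i k) i (u i) = u.
Proof.
apply/ffunP=> j; have [->|ji] := eqVneq j i; last by rewrite !upd_other.
by apply: val_inj; rewrite /= upd_same.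
Qed.

Lemma grid_upd u i k : (k < n)%N -> (k.+1 == u i) || ((u i).+1 == k) ->
  grid d n u (upd u i k).
Proof.
move=> kn adj; apply/existsP; exists i; rewrite upd_same // orbC adj /=.
by apply/forall_inP => j ji; rewrite upd_other.
Qed.

Definition grid_parity u : bool := odd (\sum_i u i).

Lemma grid_parity_adj u v : grid d n u v -> grid_parity v = ~~ grid_parity u.
Proof.
case/existsP=> i /andP[adj /forall_inP same].
rewrite /grid_parity (bigD1 i) //= [in RHS](bigD1 i) //=.
rewrite [in RHS](eq_bigr (fun j => v j : nat)); last by move=> j /same/eqP->.
by rewrite !oddD; case/orP: adj => /eqP <-; rewrite oddS; do 2 case: odd.
Qed.

Lemma grid_step u v (i j : 'I_d) : i != j -> grid d n u v ->
  `|(v i)%:Z - (u i)%:Z| + `|(v j)%:Z - (u j)%:Z| <= 1.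
Proof.
move=> ij /existsP[k /andP[adj /forall_inP same]].
have [ik|/same/eqP->] := eqVneq i k; last first.
  have [->|/same/eqP->] := eqVneq j k; lia.
have /same/eqP-> : j != k by rewrite -ik eq_sym.
by rewrite ik; lia.
Qed.

End Grid.

(** Fixing two coordinates leaves a product family of n^d functions. *)
Lemma sum_ffun2 d n (G : 'I_n -> 'I_n -> int) (i j : 'I_d.+2) : i != j ->
  \sum_(u : {ffun 'I_d.+2 -> 'I_n}) G (u i) (u j) =
  n%:Z ^+ d * \sum_x \sum_y G x y.
Proof.
move=> ij.
pose pr (u : {ffun 'I_d.+2 -> 'I_n}) := (u i, u j).
rewrite (partition_big pr xpredT) //= pair_big mulr_sumr /=.
apply: eq_bigr => -[a b] _ /=.
pose Q k : pred 'I_n :=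
  if k == i then pred1 a else if k == j then pred1 b else predT.
have QE (u : {ffun 'I_d.+2 -> 'I_n}) :
    ((u i, u j) == (a, b)) = (u \in family Q).
  apply/eqP/familyP => [[ui uj] k|H].
    rewrite /Q -ui -uj; case: eqVneq => [->|_]; first by rewrite inE.
    by case: eqVneq => [->|_]; rewrite inE.
  have := H i; have := H j; rewrite /Q eqxx eq_sym (negPf ij) eqxx !inE.
  by move=> /eqP-> /eqP->.
rewrite (eq_bigr (fun=> 1 * G a b)); last first.
  by move=> u /eqP[-> ->]; rewrite mul1r.
rewrite -mulr_suml; congr (_ * _).
rewrite (eq_bigl _ _ QE) (eq_bigr (fun u => \prod_(k < d.+2) 1)); last first.
  by move=> u _; rewrite big1.
rewrite -(bigA_distr_big_dep Q (fun _ _ => 1)).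
rewrite (bigD1 i) //= (bigD1 j) 1?eq_sym //=.
rewrite {1}/Q eqxx big_pred1_eq {1}/Q eq_sym (negPf ij) eqxx big_pred1_eq !mul1r.
rewrite (eq_bigr (fun=> n%:Z)); last first.
  by move=> k /andP[/negPf ki /negPf kj]; rewrite /Q ki kj sumr_const card_ord natz.
rewrite prodr_const; congr (_ ^+ _).
rewrite (@eq_card _ _ [predC pred2 i j]); last first.
  by move=> k; rewrite !inE negb_or.
by have := cardC (pred2 i j); rewrite card2 ij card_ord; case.
Qed.

(** * The two ring configurations *)

Section Rings.
Context {d n : nat} (i0 i1 : 'I_d).
Hypotheses (n_even : ~~ odd n) (i01 : i0 != i1).
Implicit Type u : {ffun 'I_d -> 'I_n}.

Definition transverse_parity u : bool :=
  odd (\sum_(i | (i != i0) && (i != i1)) u i).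

(* The concentric squares on slices of transverse parity [b], and horizontal
   dimers on the other slices. *)
Definition ring_partner (b : bool) u : {ffun 'I_d -> 'I_n} :=
  if transverse_parity u != b then upd u i0 (flip 0 (u i0))
  else if (margin n (u i0) <= margin n (u i1))%N
       then upd u i1 (flip (margin n (u i0)) (u i1))
       else upd u i0 (flip (margin n (u i1)).+1 (u i0)).

Lemma margin_le z : (margin n z <= z)%N.
Proof. exact: geq_minl. Qed.

Lemma transverse_parity_upd u i k : (i == i0) || (i == i1) ->
  transverse_parity (upd u i k) = transverse_parity u.
Proof.
move=> ii; rewrite /transverse_parity; congr odd; apply: eq_bigr => j.
move=> /andP[j0 j1]; rewrite upd_other //.
by case/orP: ii => /eqP->.
Qed.

Lemma ring_partner_adj b u : grid d n u (ring_partner b u).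
Proof.
have flip_adj i j : (j <= margin n (u i))%N -> grid d n u (upd u i (flip j (u i))).
  move=> ji; have [fn _] := flip_margin _ _ _ n_even (ltn_ord (u i)) ji.
  exact: grid_upd fn (flip_dist _ _ (leq_trans ji (margin_le _))).
rewrite /ring_partner; case: ifP => _; first exact: flip_adj.
by case: leqP => m01; apply: flip_adj.
Qed.

(** A partner lies on the same side of the same square. Vertical sides own the corners, so
    horizontal ones start one step further in, whence the [.+1]; both have even length. *)
Lemma ring_partnerK b : involutive (ring_partner b).
Proof.
move=> u; have fM j i := flip_margin _ j (u i) n_even (ltn_ord (u i)).
have updfK i j : (j <= margin n (u i))%N ->
    upd (upd u i (flip j (u i))) i (flip j (flip j (u i))) = u.
  by move=> ji; rewrite (flipK n) // updK.
rewrite {2}/ring_partner; case: ifP => tb.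
  have [fn _] := fM 0 i0 (leq0n _).
  by rewrite /ring_partner transverse_parity_upd ?eqxx // tb upd_same // updfK.
case: leqP => m01; rewrite /ring_partner transverse_parity_upd ?eqxx ?orbT // tb.
  have [fn fm] := fM _ _ m01.
  by rewrite [upd _ _ _ i0]upd_other // upd_same // fm updfK.
have [fn fm] := fM _ _ m01.
rewrite [upd _ _ _ i1]upd_other 1?eq_sym // upd_same //.
by rewrite leqNgt fm /= updfK.
Qed.

(** A vertical dimer gives dy the sign of [u i1 + margin n (u i0)]; in the product with the grid
    parity, [u i1] cancels. *)
Lemma ring_partner_moment b u :
  (-1) ^+ grid_parity u * (u i0)%:Z * ((ring_partner b u i1)%:Z - (u i1)%:Z) =
  if (transverse_parity u == b) && (margin n (u i0) <= margin n (u i1))%N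
  then (-1) ^+ b * ((-1) ^+ (u i0 + margin n (u i0)) * (u i0)%:Z) else 0.
Proof.
rewrite /ring_partner; case: eqVneq => [<-|_] /=; last first.
  by rewrite upd_other 1?eq_sym // subrr mulr0.
case: leqP => m01; last by rewrite upd_other 1?eq_sym // subrr mulr0.
have [fn _] := flip_margin _ _ _ n_even (ltn_ord (u i1)) m01.
rewrite upd_same // flipB ?(leq_trans m01 (margin_le _)) //.
rewrite /grid_parity (bigD1 i0) //= (bigD1 i1) 1?eq_sym //= signr_odd.
rewrite mulrAC [RHS]mulrA; congr (_ * _).
rewrite signr_odd -!exprD -[LHS]signr_odd -[RHS]signr_odd.
congr (_ ^+ nat_of_bool _).
by rewrite !oddD; do 4! case: (odd _).
Qed.

Definition ring_matching b : dimer_config (grid d n) :=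
  DimerConfig (partner_matchingP _ _
    (ring_partnerK b) (ring_partner_adj b)).

Definition ring_moment b : int :=
  total_moment grid_parity (fun u => (u i0)%:Z) (fun u => (u i1)%:Z)
    (ring_matching b).

Lemma ring_momentE b : ring_moment b =
  \sum_(u | (transverse_parity u == b) &&
            (margin n (u i0) <= margin n (u i1))%N)
     (-1) ^+ b * ((-1) ^+ (u i0 + margin n (u i0)) * (u i0)%:Z).
Proof.
rewrite /ring_moment /= (total_moment_partner (grid d n)); first last.
- exact: ring_partner_adj.
- exact: ring_partnerK.
- exact: grid_parity_adj.
by rewrite [RHS]big_mkcond; apply: eq_bigr => u _; rewrite ring_partner_moment.
Qed.

(** The factor [(-1) ^+ b] turns the difference into a sum with one common sign over the slices of
    both parities. *)
Lemma ring_momentB : ring_moment true - ring_moment false =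
  - \sum_(u : {ffun 'I_d -> 'I_n} | (margin n (u i0) <= margin n (u i1))%N)
     (-1) ^+ (u i0 + margin n (u i0)) * (u i0)%:Z.
Proof.
rewrite !ring_momentE.
rewrite [in RHS](bigID (fun u => transverse_parity u == true)) /=.
rewrite opprD -!sumrN; congr (_ + _).
  by apply: eq_big => [u|u _]; rewrite 1?andbC // expr1 mulN1r.
by apply: eq_big => [u|u _]; rewrite 1?andbC ?eqb_id ?eqbF_neg // expr0 mul1r.
Qed.

End Rings.

(** * The diameter bound *)

Theorem theorem1p7 (d l n : nat) (hd : (2 <= d)%N) (hl : (2 <= l)%N)
    (hn : (2 <= n)%N) (n_even : ~~ odd n) :
  ((n%:R ^+ d.-1 * (n%:R ^+ 2 - 1) / (6 * l%:R ^+ 2) : rat)%:E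
     <= diameter (dimer_graph (grid d n) l))%E.
Proof.
case: d hd => [|[|d]] // _.
pose i0 : 'I_d.+2 := ord0; pose i1 : 'I_d.+2 := lift ord0 ord0.
have i01 : i0 != i1 by [].
pose M b := ring_matching i0 i1 n_even i01 b.
apply: (@le_trans _ _
    (gdist (dimer_graph (grid d.+2 n) l) (M false) (M true))); last first.
  apply: le_trans (le_bigmax _ _ (M false)).
  exact: (le_bigmax _ _ (M true)).
rewrite /gdist; case: {-}_ / boolP => [cMM|_]; last by rewrite leey.
case: ex_minnP => k wk _; rewrite lee_fin.
pose X i (u : {ffun 'I_d.+2 -> 'I_n}) := (u i)%:Z.
have := total_moment_walk _ _ (X i0) (X i1) grid_parity_adj
  (fun u v => grid_step u v i0 i1 i01) _ _ _ _ wk.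
rewrite -!/(ring_moment _ _ n_even i01 _) ring_momentB normrN => walkD.
(* Here [d] is the dimension minus two, so there are n^d slices, and [ringG] bounds the contribution
   of each. *)
have E : n%:Z ^+ d.+1 * (n%:Z ^+ 2 - 1) <= k%:Z * (6 * l%:Z ^+ 2).
  pose G (x y : 'I_n) := if (margin n x <= margin n y)%N
    then (-1) ^+ (x + margin n x) * x%:Z else 0.
  rewrite big_mkcond (sum_ffun2 _ _ G _ _ i01) in walkD.
  have ringG : n%:Z * (n%:Z ^+ 2 - 1) <= 6 * - \sum_x \sum_y G x y.
    by have := ring_sum _ n_even; under eq_bigr => x _ do rewrite big_mkcond.
  rewrite exprSr -mulrA (le_trans (ler_wpM2l _ ringG)) ?exprn_ge0 //.
  rewrite mulrCA [leRHS]mulrCA ler_pM2l // (le_trans _ walkD) //.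
  by rewrite mulrN -normrN ler_norm.
rewrite ler_pdivrMr; last by rewrite mulr_gt0 // exprn_gt0 // ltr0n; lia.
move: E; rewrite -(ler_int rat).
by rewrite !intrM intrB !rmorphXn.
Qed.
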